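(* Let $N=\{1,\dots,n\}$, let $K$ be a finite index set, let $A_k\subseteq N$ for $k\in K$ be nonempty and pairwise disjoint sets with $\bigcup_{k\in K}A_k=N$, and for $i\in N$ let $K(i)$ denote the unique $k\in K$ with $i\in A_k$. Let $E\subseteq\{(i,j)\in N\times N\mid i\le j\}$ and let $w_{eqn},w_{var}\ge 0$. Then the algorithm ConstructSets (defined in the context) terminates after $O(n^3)$ elementary operations, and its output sets $F$ and $B_k$, $k\in K$, form an optimal solution of the following mixed-integer program, via $z_{ik}=1$ if $i\in B_k$ and $z_{ik}=0$ otherwise, and $f_{ij}=1$ if $(i,j)\in F$ and $f_{ij}=0$ otherwise: $$\begin{aligned} \min\ & w_{eqn}\sum_{k\in K}\sum_{1\le i\le n}z_{ik}+w_{var}\sum_{1\le i\le n}\ \sum_{i\le j\le n}f_{ij}\\ \text{s.t. } & f_{ij}=1 &&\text{for all }(i,j)\in E,\\ & f_{ij}\ge z_{jk} &&\text{for all }k\in K,\ i\in A_k,\ j\in N,\ i\le j,\\ & f_{ji}\ge z_{jk} &&\text{for all }k\in K,\ i\in A_k,\ j\in N,\ j<i,\\ & \sum_{k\in K:\,i\in A_k}z_{jk}\ge f_{ij} &&\text{for all }1\le i\le j\le n,\\ & \sum_{k\in K:\,j\in A_k}z_{ik}\ge f_{ij} &&\text{for all }1\le i\le j\le n,\\ & f_{ij}\in[0,1] &&\text{for all }1\le i\le j\le n,\\ & z_{ik}\in\{0,1\} &&\text{for all }k\in K,\ 1\le i\le n. \end{aligned}$$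
   Context: Write $\phi(a,b)=(a,b)$ if $a\le b$ and $\phi(a,b)=(b,a)$ otherwise. Algorithm ConstructSets. Input: $E$, $K$, the sets $A_k$ ($k\in K$), and the map $i\mapsto K(i)$. Initialize $B_k\gets\emptyset$ for all $k\in K$, $F\gets E$ and $F_{new}\gets E$. Repeat the following round. Set $F_{add}\gets\emptyset$. For each $(i,j)\in F_{new}$, let $k^*=K(i)$ and $l^*=K(j)$ and do: (a) if $j\notin B_{k^*}$, then add $j$ to $B_{k^*}$ and, for every $a\in A_{k^*}$ with $\phi(a,j)\notin F$, add $\phi(a,j)$ to $F_{add}$; (b) if $i\notin B_{l^*}$, then add $i$ to $B_{l^*}$ and, for every $a\in A_{l^*}$ with $\phi(a,i)\notin F$, add $\phi(a,i)$ to $F_{add}$. If $F_{add}=\emptyset$ after the round, stop and return $F$ and the sets $B_k$, $k\in K$. Otherwise set $F\gets F\cup F_{add}$ and $F_{new}\gets F_{add}$ and start the next round. Elementary operations include testing membership in, and inserting an element into, one of the sets $F$, $F_{add}$, $B_k$. In the mixed-integer program, $z_{ik}=1$ encodes $i\in B_k$ and $f_{ij}=1$ encodes $(i,j)\in F$; the weights $w_{eqn}$ and $w_{var}$ control the emphasis on the number of additional equations and the number of additional variables, respectively, of a compact linearization of a binary quadratic program with products indexed by $E$ and assignment constraints $\sum_{i\in A_k}x_i=1$, $k\in K$. *)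

(* Defs.v *)
From mathcomp Require Import all_boot all_order all_algebra.
Set Implicit Arguments.
Unset Strict Implicit.
Unset Printing Implicit Defensive.
Import Order.TTheory GRing.Theory Num.Theory.

(* N = {1, ..., n} is represented by 'I_n = {0, ..., n-1}. *)

(** * Computations that count their elementary operations *)

(* The result of a computation together with the number of elementary
   operations it used; [op x] is one elementary operation with result [x]. *)
Definition counted (T : Type) : Type := (T * nat)%type.
Definition ret T (x : T) : counted T := (x, 0).
Definition op T (x : T) : counted T := (x, 1).
Definition bind T U (m : counted T) (f : T -> counted U) : counted U :=
  let r := f m.1 in (r.1, m.2 + r.2).

Notation "'let*' x ':=' m 'in' p" := (bind m (fun x => p))
  (at level 200, x name, m at level 100, p at level 200,
   format "'[v' 'let*'  x  ':='  m  'in' '/' p ']'").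

(* One operation per element for fetching it, and one for detecting the end. *)
Fixpoint for_each T S (s : seq T) (body : T -> S -> counted S) (st : S) :
    counted S :=
  if s is x :: s' then
    let* y := op x in
    let* st' := body y st in
    for_each s' body st'
  else op st.

(* Inserting the elements of D into S one at a time: #|D| operations. *)
Definition insert_all (T : finType) (D S : {set T}) : counted {set T} :=
  (S :|: D, #|D|).

Definition enumerates (T : finType) (s : seq T) (S : {set T}) : Prop :=
  uniq s /\ s =i S.

(** * Algorithm ConstructSets *)

Section ConstructSets.
Variables (n : nat) (K : finType).

Notation pair := ('I_n * 'I_n)%type.
Notation family := {ffun K -> {set 'I_n}}.

Definition phi (a b : 'I_n) : pair := if (a <= b)%N then (a, b) else (b, a).

Definition insert_in (B : family) (k : K) (j : 'I_n) : family :=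
  [ffun l => if l == k then j |: B l else B l].

Variables (Kof : 'I_n -> K).
(* The for-loops of the algorithm leave the order of iteration open:
   [elems k] lists A_k, and [order r S] lists the set S = F_new in round r. *)
Variables (elems : K -> seq 'I_n) (order : nat -> {set pair} -> seq pair).

(* Step (a) is [add_to F j (Kof i)], step (b) is [add_to F i (Kof j)]; the
   state consists of the sets B_k and F_add. *)
Definition add_to (F : {set pair}) (j : 'I_n) (k : K)
    (st : family * {set pair}) : counted (family * {set pair}) :=
  let* present := op (j \in st.1 k) in
  if present then ret st else
  let* B := op (insert_in st.1 k j) in
  let* Fadd := for_each (elems k) (fun a Fa =>
                 let* p := op (phi a j) in
                 let* inF := op (p \in F) in
                 if inF then ret Fa else op (p |: Fa)) st.2 in
  ret (B, Fadd).

Definition process (F : {set pair}) (p : pair) (st : family * {set pair}) :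
    counted (family * {set pair}) :=
  let* k := op (Kof p.1) in
  let* l := op (Kof p.2) in
  let* st' := add_to F p.2 k st in
  add_to F p.1 l st'.

(* The body of one round, including the test whether F_add is empty. *)
Definition round (F : {set pair}) (s : seq pair) (B : family) :
    counted (family * {set pair} * bool) :=
  let* Fadd0 := op set0 in
  let* st := for_each s (process F) (B, Fadd0) in
  let* stop := op (st.2 == set0) in
  ret (st, stop).

(* F <- F U F_add and F_new <- F_add. *)
Definition update (F Fadd : {set pair}) : counted ({set pair} * {set pair}) :=
  let* F' := insert_all Fadd F in
  let* Fnew' := insert_all Fadd set0 in
  ret (F', Fnew').

(* [rounds r F Fnew B F' B' t]: started at round r with the given sets, the
   main loop stops, returns F' and B', and uses t elementary operations.  The
   two rules exclude each other, so F', B' and t are determined by the rest;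
   a loop running forever has no derivation. *)
Inductive rounds (r : nat) (F Fnew : {set pair}) (B : family) :
    {set pair} -> family -> nat -> Prop :=
| Rounds_stop B' Fadd t :
    round F (order r Fnew) B = (B', Fadd, true, t) ->
    rounds r F Fnew B F B' t
| Rounds_next B1 Fadd F1 Fnew1 t u F' B' v :
    round F (order r Fnew) B = (B1, Fadd, false, t) ->
    update F Fadd = (F1, Fnew1, u) ->
    rounds r.+1 F1 Fnew1 B1 F' B' v ->
    rounds r F Fnew B F' B' (t + u + v).

Definition initialize (E : {set pair}) :
    counted (family * {set pair} * {set pair}) :=
  (* one assignment B_k <- set0 per k, hence the loop *)
  let* B := for_each (enum K)
              (fun k (B : family) => op [ffun l => if l == k then set0 else B l])
              ([ffun=> set0] : family) in
  let* F := insert_all E set0 in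
  let* Fnew := insert_all E set0 in
  ret (B, F, Fnew).

(* ConstructSets terminates on this input, with output F' and B', after
   exactly t elementary operations. *)
Definition construct_sets (E : {set pair}) (F' : {set pair}) (B' : family)
    (t : nat) : Prop :=
  exists B F Fnew u v,
    [/\ initialize E = (B, F, Fnew, u),
        rounds 0 F Fnew B F' B' v
      & t = u + v].

End ConstructSets.

(** * The mixed-integer program *)

Section MIP.
Local Open Scope ring_scope.
Variables (R : realFieldType) (n : nat) (K : finType).
Variables (A : K -> {set 'I_n}) (E : {set 'I_n * 'I_n}) (w_eqn w_var : R).

(* Only the entries f i j with i <= j are variables of the program; the others
   occur neither in the constraints nor in the objective. *)
Implicit Types (f : 'I_n -> 'I_n -> R) (z : 'I_n -> K -> R).

Definition objective f z : R :=
  w_eqn * (\sum_(k : K) \sum_(i < n) z i k)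
  + w_var * (\sum_(i < n) \sum_(j < n | (i <= j)%N) f i j).

Record feasible f z : Prop := Feasible {
  f_E : forall i j : 'I_n, (i, j) \in E -> f i j = 1;
  f_ge_z : forall (k : K) (i j : 'I_n), i \in A k -> (i <= j)%N -> f i j >= z j k;
  f_ge_z' : forall (k : K) (i j : 'I_n), i \in A k -> (j < i)%N -> f j i >= z j k;
  z_ge_f : forall i j : 'I_n, (i <= j)%N ->
    \sum_(k : K | i \in A k) z j k >= f i j;
  z_ge_f' : forall i j : 'I_n, (i <= j)%N ->
    \sum_(k : K | j \in A k) z i k >= f i j;
  f_unit : forall i j : 'I_n, (i <= j)%N -> 0 <= f i j <= 1;
  z_binary : forall i k, z i k = 0 \/ z i k = 1
}.

Definition optimal f z : Prop :=
  feasible f z /\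
  forall f' z', feasible f' z' -> objective f z <= objective f' z'.

End MIP.

(* Main.v *)
Require Import Defs.
From mathcomp Require Import all_boot all_order all_algebra.
From mathcomp Require Import zify.
Set Implicit Arguments.
Unset Strict Implicit.
Unset Printing Implicit Defensive.
Import Order.TTheory GRing.Theory Num.Theory.
Local Open Scope ring_scope.

(** Call a pair (C, D) closed if C contains E and the implications
    "(i,j) in C => j in D_{K(i)} and i in D_{K(j)}" and
    "j in D_k, a in A_k => phi(a,j) in C" hold.  The algorithm computes the
    least closed pair.  The indicator functions of a closed pair are feasible
    for the mixed-integer program and, conversely, the entries equal to 1 of any
    feasible point form a closed pair; so the least one is optimal for
    nonnegative weights.

    For the running time, each pair is processed in at most one round, and each
    j is inserted at most once into each B_k, at a cost of O(1 + |A_k|); as the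
    A_k are disjoint and nonempty, everything sums up to O(n^2).  The insertions
    are accounted for by the potential sum_k |B_k| (4 |A_k| + 2). *)

(** The invariant [I] is indexed by the elements still to be visited. A step pays [c] itself and
    charges the rest to the growth of [pot]; fetching adds one to [c], and detecting the end of the
    list adds one overall. *)
Lemma for_each_amortized (T : Type) (S : Type) (I : seq T -> S -> Prop)
    (pot : S -> nat) (c : nat) (body : T -> S -> counted S) (s : seq T) (st : S) :
  (forall x s' st', I (x :: s') st' ->
     I s' (body x st').1 /\
     ((body x st').2 + pot st' <= c + pot (body x st').1)%N) ->
  I s st ->
  I [::] (for_each s body st).1 /\
  ((for_each s body st).2 + pot st
     <= c.+1 * size s + 1 + pot (for_each s body st).1)%N.
Proof.
move=> step; elim: s st => [|x s IH] st Ist /=; first by split=> //; lia.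
have [I1 c1] := step _ _ _ Ist; have [I2 c2] := IH _ I1.
by split=> //; rewrite /bind /=; lia.
Qed.

(** * Closed pairs and the mixed-integer program *)

Section LeastClosedPair.
Variables (n : nat) (K : finType) (A : K -> {set 'I_n}) (Kof : 'I_n -> K).
Variable E : {set 'I_n * 'I_n}.

Definition processed (D : K -> {set 'I_n}) (p : 'I_n * 'I_n) : Prop :=
  p.2 \in D (Kof p.1) /\ p.1 \in D (Kof p.2).

Record closed (C : {set 'I_n * 'I_n}) (D : K -> {set 'I_n}) : Prop := Closed {
  closed_sub : E \subset C;
  closed_processed : forall p, p \in C -> processed D p;
  closed_phi : forall k j a, j \in D k -> a \in A k -> phi a j \in C
}.

Definition least_closed C D : Prop :=
  closed C D /\
  forall C' D', closed C' D' -> C \subset C' /\ forall k, D k \subset D' k.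

Lemma phi_le (a b : 'I_n) : ((phi a b).1 <= (phi a b).2)%N.
Proof. by rewrite /phi; case: (leqP a b) => //= /ltnW. Qed.

Hypothesis E_le : forall i j : 'I_n, (i, j) \in E -> (i <= j)%N.

(** The partition in the form used below: the classes are the fibres of [Kof], so a sum over the
    classes containing [i] has a single term. *)
Hypothesis A_fiber : forall i k, (i \in A k) = (k == Kof i).

Lemma sum_class (R : realFieldType) (i : 'I_n) (g : K -> R) :
  \sum_(k : K | i \in A k) g k = g (Kof i).
Proof. by under eq_bigl do rewrite A_fiber; rewrite big_pred1_eq. Qed.

(** The sum constraints collapse to one [z], and a binary [z] that is at least 1 equals 1;
    conversely [z = 1] pushes [f] up to its upper bound 1. Fractional entries of [f] count as
    absent. *)
Lemma feasible_closed (R : realFieldType) (f : 'I_n -> 'I_n -> R) z :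
  feasible A E f z ->
  closed [set p : 'I_n * 'I_n | (p.1 <= p.2)%N && (f p.1 p.2 == 1)]
         (fun k => [set i | z i k == 1]).
Proof.
move=> [fE fz fz' zf zf' fu zb].
have z1 i k : 1 <= z i k -> z i k == 1.
  by case: (zb i k) => -> //; rewrite ler10.
split=> [|[i j]|k j a].
- by apply/subsetP=> -[i j] ijE; rewrite inE /= fE // eqxx E_le.
- rewrite inE /= => /andP[ij /eqP f1].
  have := zf _ _ ij; have := zf' _ _ ij.
  by rewrite !sum_class f1 => z2 z3; split; rewrite inE z1.
- rewrite !inE phi_le /= => /eqP zj ak; rewrite /phi.
  case: (leqP a j) => /= aj.
    have /andP[_ f1] := fu _ _ aj.
    by rewrite eq_le f1 -zj fz.
  have /andP[_ f1] := fu _ _ (ltnW aj).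
  by rewrite eq_le f1 -zj (fz' k).
Qed.

Lemma least_closed_optimal (R : realFieldType) (w_eqn w_var : R) C D :
  0 <= w_eqn -> 0 <= w_var -> least_closed C D ->
  optimal A E w_eqn w_var
    (fun i j => ((i, j) \in C)%:R) (fun i k => (i \in D k)%:R).
Proof.
move=> w1 w2 lCD; have [[EC Cp Cphi] least] := lCD; split.
  split=> [i j /(subsetP EC) -> //|k i j ik ij|k i j ik ji|i j ij|i j ij|i j ij|i k].
  - rewrite ler_nat; case jk: (j \in D k) => //.
    by have := Cphi _ _ _ jk ik; rewrite /phi ij => ->.
  - rewrite ler_nat; case jk: (j \in D k) => //.
    by have := Cphi _ _ _ jk ik; rewrite /phi leqNgt ji /= => ->.
  - rewrite sum_class ler_nat; case ijC: (_ \in C) => //.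
    by have [/= ->] := Cp _ ijC.
  - rewrite sum_class ler_nat; case ijC: (_ \in C) => //.
    by have [/= _ ->] := Cp _ ijC.
  - by rewrite ler0n lern1 leq_b1.
  - by case: (_ \in _); [right | left].
(* The comparison is termwise: on [C] and [D] leastness forces the value 1 in the feasible point;
   elsewhere the indicator is 0 and the entries are nonnegative. *)
move=> f z feas; have [/subsetP fC zD] := least _ _ (feasible_closed feas).
apply: lerD; apply: ler_wpM2l => //.
  apply: ler_sum => k _; apply: ler_sum => i _.
  case iD: (i \in D k); last by case: (z_binary feas i k) => ->.
  by have := subsetP (zD k) _ iD; rewrite inE => /eqP ->.
apply: ler_sum => i _; apply: ler_sum => j ij.
case ijC: (_ \in C); last by case/andP: (f_unit feas ij).
by have := fC _ ijC; rewrite inE /= => /andP[_ /eqP ->].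
Qed.

(** * Correctness and amortized cost of the algorithm *)

Local Open Scope nat_scope.

Variables (elems : K -> seq 'I_n).
Variables (order : nat -> {set 'I_n * 'I_n} -> seq ('I_n * 'I_n)).
Hypothesis elemsP : forall k, enumerates (elems k) (A k).
Hypothesis orderP : forall r S, enumerates (order r S) S.

Local Notation pairs := {set 'I_n * 'I_n}.
Local Notation family := {ffun K -> {set 'I_n}}.

Lemma size_enumerates (T : finType) (s : seq T) (S : {set T}) :
  enumerates s S -> size s = #|S|.
Proof. by case=> /card_uniqP <- /eq_card ->. Qed.

(** Price of a new element of [B k]: one operation for the insertion, four per element of [A k]
    (fetch, [phi], test in [F], insertion), and one for the end of the loop. *)
Definition weight (k : K) : nat := 4 * #|A k| + 2.

Definition potential (B : K -> {set 'I_n}) : nat :=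
  \sum_k #|B k| * weight k.

(** By [inv_least] everything collected so far is forced. Disjointness makes cardinalities add up at
    the end of a round. *)
Record round_inv (F : pairs) (B : family) (Fadd : pairs) : Prop := RoundInv {
  inv_new : [disjoint Fadd & F];
  inv_phi : forall k j a, j \in B k -> a \in A k -> phi a j \in F :|: Fadd;
  inv_least : forall C D, closed C D ->
    Fadd \subset C /\ forall k, B k \subset D k
}.

Lemma add_loop_spec (F Fa : pairs) (j : 'I_n) (k : K) :
  let r := for_each (elems k) (fun a Fa =>
                 let* p := op (phi a j) in
                 let* inF := op (p \in F) in
                 if inF then ret Fa else op (p |: Fa)) Fa in
  r.1 = Fa :|: ([set phi a j | a in A k] :\: F) /\ r.2 < weight k.
Proof.
set body := fun _ => _; move=> r.
pose target (s : seq 'I_n) := [set phi a j | a in s] :\: F.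
(* The pairs collected so far together with those still to come form a constant set. *)
pose I (s : seq 'I_n) (Fb : pairs) :=
  Fb :|: target s = Fa :|: target (elems k).
have [|//|] := @for_each_amortized _ _ I (fun=> 0) 3 body (elems k) Fa.
  move=> a s Fb; rewrite /I => <-; rewrite /body /bind /=.
  have -> : target (a :: s) = ([set phi a j] :\: F) :|: target s.
    rewrite /target -setDUl; congr (_ :\: _); apply/setP=> p.
    rewrite !inE; apply/imsetP/orP => [[b + ->]|].
      rewrite inE => /predU1P[-> | bs]; first by left.
      by right; apply: imset_f.
    case=> [/eqP-> | /imsetP[b bs ->]].
      by exists a; rewrite // !inE eqxx.
    by exists b; rewrite // !inE bs orbT.
  case: ifPn => aF /=; split=> //; apply/setP=> p; rewrite !inE.
    by case: eqP => [->|_]; rewrite ?aF ?andbF.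
  case: eqP => [->|_] /=; first by rewrite aF /= !orbT.
  by rewrite andbF.
rewrite -/r /I /target => eq1 cost.
have e0 : [set phi a j | a in [::]] = set0 :> pairs.
  by apply/setP=> p; rewrite inE; apply/imsetP=> -[].
rewrite e0 set0D setU0 in eq1.
have [_ memA] := elemsP k.
rewrite (size_enumerates (elemsP k)) in cost.
split; last by move: cost; rewrite !addn0 /weight addn2 addn1.
rewrite eq1; congr (_ :|: (_ :\: _)); apply/setP=> p.
by apply/imsetP/imsetP=> -[a ak ->]; exists a; rewrite // ?memA // -memA.
Qed.

(** Shared by a single step (a) or (b) and by the processing of a pair. [new] is the membership
    achieved; since the sets only grow, it survives later steps. *)
Definition add_spec (F : pairs) (cost : nat) (new : family -> Prop)
    (st : family * pairs) (r : counted (family * pairs)) : Prop :=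
  [/\ round_inv F r.1.1 r.1.2, new r.1.1,
      forall k, st.1 k \subset r.1.1 k
    & r.2 + potential st.1 <= cost + potential r.1.1].

Lemma potential_insert (B : family) (k : K) (j : 'I_n) :
  j \notin B k ->
  potential (insert_in B k j) = potential B + weight k.
Proof.
move=> jB; rewrite /potential (bigD1 k) //= [in RHS](bigD1 k) //=.
rewrite ffunE eqxx cardsU1 jB.
under eq_bigr => l lk do rewrite ffunE (negPf lk).
by rewrite mulSn [RHS]addnC addnA.
Qed.

(** The unit cost is the membership test; the growth of the potential by [weight k] pays for a real
    insertion. As [j] lies in [D k] for every closed pair, inserting it preserves [inv_least]. *)
Lemma add_to_spec (F : pairs) (j : 'I_n) (k : K) st :
  round_inv F st.1 st.2 ->
  (forall C D, closed C D -> j \in D k) ->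
  add_spec F 1 (fun B => j \in B k) st (add_to elems F j k st).
Proof.
case: st => B Fa inv jmin; rewrite /add_to.
move: (for_each _ _ _) (add_loop_spec F (B, Fa).2 j k) => r /= [eq1 cost].
rewrite /bind /=; case: ifPn => jB; first by split.
have [FaF Bphi least] := inv.
split=> /=.
- rewrite eq1; split.
  + rewrite -setI_eq0; apply/eqP/setP=> p; rewrite !inE andb_orl.
    case pF: (p \in F); last by rewrite !andbF.
    by rewrite (disjointFl FaF pF).
  + move=> l i a; rewrite ffunE; case: eqP => [->|_] iB ak; last first.
      by have := Bphi _ _ _ iB ak; rewrite !inE => /orP[] ->; rewrite ?orbT.
    move: iB; rewrite !inE => /predU1P[-> | iB].
      have -> : phi a j \in [set phi b j | b in A k] by apply/imsetP; exists a.
      by rewrite andbT orbCA orbN orbT.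
    by have := Bphi _ _ _ iB ak; rewrite !inE => /orP[] ->; rewrite ?orbT.
  + move=> C D clo; have [FaC BD] := least _ _ clo; have jD := jmin _ _ clo.
    split=> [|l].
      rewrite subUset FaC /=; apply/subsetP=> p.
      rewrite inE => /andP[_ /imsetP[a ak ->]].
      exact: (closed_phi clo jD ak).
    by rewrite ffunE; case: eqP => [->|_]; rewrite ?subUset ?sub1set ?jD BD.
- by rewrite ffunE eqxx setU11.
- by move=> l; rewrite ffunE; case: eqP => // _; rewrite subsetUr.
- by rewrite potential_insert //; lia.
Qed.

(** The cost 4 is two class look-ups plus two membership tests. *)
Lemma process_spec (F : pairs) (p : 'I_n * 'I_n) st :
  round_inv F st.1 st.2 ->
  (forall C D, closed C D -> processed D p) ->
  add_spec F 4 (fun B => processed B p) st (process Kof elems F p st).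
Proof.
move=> inv pmin.
pose r1 := add_to elems F p.2 (Kof p.1) st.
pose r2 := add_to elems F p.1 (Kof p.2) r1.1.
have -> : process Kof elems F p st = (r2.1, 2 + (r1.2 + r2.2)) by [].
have spec1 : add_spec F 1 (fun B => p.2 \in B (Kof p.1)) st r1.
  by apply: add_to_spec => // C D /pmin[].
have {pmin} : add_spec F 1 (fun B => p.1 \in B (Kof p.2)) r1.1 r2.
  by apply: add_to_spec; [case: spec1 | move=> C D /pmin[]].
move: r2 => r2 [inv2 new2 sub2 cost2].
move: r1 spec1 sub2 cost2 => r1 [inv1 new1 sub1 cost1] sub2 cost2.
split=> //=; last by lia.
- by split=> //; exact: subsetP (sub2 _) _ new1.
- by move=> k; exact: subset_trans (sub1 k) (sub2 k).
Qed.

(** State at the start of a round. Older pairs of [F] are already processed, so treating [Fnew]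
    alone suffices. *)
Record loop_inv (F Fnew : pairs) (B : family) : Prop := LoopInv {
  loop_E : E \subset F;
  loop_new : Fnew \subset F;
  loop_processed : forall p, p \in F -> p \notin Fnew -> processed B p;
  loop_round : round_inv F B set0;
  loop_least : forall C D, closed C D -> F \subset C
}.

Lemma round_spec (r : nat) (F Fnew : pairs) (B : family) :
  loop_inv F Fnew B ->
  let res := round Kof elems F (order r Fnew) B in
  let B' := res.1.1.1 in
  [/\ round_inv F B' res.1.1.2,
      res.1.2 = (res.1.1.2 == set0),
      forall p, p \in F -> processed B' p
    & res.2 + potential B <= 5 * #|Fnew| + 3 + potential B'].
Proof.
move=> [EF newF Fproc inv Fmin] res.
have [_ mem_order] := orderP r Fnew.
pose I (s : seq ('I_n * 'I_n)) (st : family * pairs) :=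
  [/\ round_inv F st.1 st.2, {subset s <= F}
    & forall p, p \in F -> p \notin s -> processed st.1 p].
pose loop := for_each (order r Fnew) (process Kof elems F) (B, set0).
have resE : res = (loop.1, loop.1.2 == set0, 1 + (loop.2 + (1 + 0))) by [].
have [||] := @for_each_amortized _ _ I (fun st => potential st.1) 4
    (process Kof elems F) (order r Fnew) (B, set0).
- move=> p s st [inv1 sF proc1].
  have [|inv2 new2 sub2 cost2] := @process_spec F p st inv1.
    (* [p] lies in [F], hence in every closed [C], so the insertions it triggers are forced. *)
    move=> C D clo; apply: (closed_processed clo).
    by apply: subsetP (Fmin _ _ clo) _ _; apply: sF; rewrite inE eqxx.
  split; last by lia.
  split=> // [q qs|q qF qs]; first by apply: sF; rewrite inE qs orbT.
  have [->//|qp] := eqVneq q p.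
  have [] := proc1 q qF; first by rewrite inE negb_or qp.
  by split; apply: subsetP (sub2 _) _ _.
- split=> //= [p|p pF]; rewrite mem_order; first exact: subsetP newF p.
  exact: Fproc.
- have size_order : size (order r Fnew) = #|Fnew| by exact: size_enumerates.
  rewrite {}resE size_order -/loop.
  move: loop => loop [inv' _ proc'] /= cost.
  split=> /=; [exact: inv' | by [] | by move=> p pF; apply: proc' | by lia].
Qed.

(** Induction on the number of pairs outside [F], which drops because a nonempty [Fadd] is disjoint
    from [F]. Each new pair is charged 10: two for the update, five for its processing in the next
    round, and three covering that round's fixed cost. *)
Lemma rounds_spec (r : nat) (F Fnew : pairs) (B : family) :
  loop_inv F Fnew B ->
  exists F' B' t,
    [/\ rounds Kof elems order r F Fnew B F' B' t, least_closed F' B'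
      & t + potential B + 10 * #|F|
          <= potential B' + 10 * #|F'| + 5 * #|Fnew| + 3].
Proof.
have [m] := ubnP #|~: F|.
elim: m r F Fnew B => // m IH r F Fnew B Fm inv.
have := round_spec r inv.
case res: (round _ _ _ _ _) => [[[B1 Fadd] stop] t] /= [inv1 stopE proc1 cost].
have [EF newF _ _ Fmin] := inv; have [dis Bphi least] := inv1.
case: stop stopE res => /esym stopE res.
  exists F, B1, t; split; [exact: Rounds_stop res| |by lia].
  split=> [|C D clo]; last by split; [apply: Fmin clo|case: (least _ _ clo)].
  (* With [Fadd] empty, [inv_phi] becomes the last closure condition for [F]. *)
  split=> // k j a jB ak; have := Bphi _ _ _ jB ak.
  by rewrite (eqP stopE) setU0.
have Fadd0 : 0 < #|Fadd| by rewrite card_gt0 stopE.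
have cardU : #|F :|: Fadd| = #|F| + #|Fadd|.
  by apply/eqP; rewrite (leq_card_setU F Fadd) disjoint_sym.
have [|| F' [B' [v [run2 lcl cost2]]]] := IH r.+1 (F :|: Fadd) Fadd B1.
- by have := cardsC F; have := cardsC (F :|: Fadd); lia.
- split=> [||p||C D clo].
  + exact: subset_trans EF (subsetUl _ _).
  + exact: subsetUr.
  + by rewrite inE => /orP[/proc1|->].
  + split; first by rewrite disjoints_subset sub0set.
    * by move=> k j a; rewrite setU0; apply: Bphi.
    * by move=> C D clo; rewrite sub0set; case: (least _ _ clo).
  + by rewrite subUset (Fmin _ _ clo); case: (least _ _ clo).
exists F', B', (t + (#|Fadd| + (#|Fadd| + 0)) + v); split=> //; last first.
  move: cost cost2 Fadd0; rewrite cardU.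
  by move: #|F| #|Fadd| #|Fnew| #|F'| (potential B1) => a b c d e; lia.
apply: Rounds_next res _ run2.
by rewrite /update /bind /= set0U.
Qed.

Lemma initialize_spec :
  exists t, initialize K E = ([ffun=> set0], E, E, t)
         /\ t <= 2 * #|K| + 1 + 2 * #|E|.
Proof.
pose body := fun k (B : family) => op [ffun l => if l == k then set0 else B l].
pose B0 : family := [ffun=> set0].
pose loop := for_each (enum K) body B0.
have -> : initialize K E = (loop.1, set0 :|: E, set0 :|: E,
    loop.2 + (#|E| + (#|E| + 0))) by by [].
have [||] := @for_each_amortized _ _ (fun _ B => B = B0) (fun=> 0) 1 body
    (enum K) B0 => //.
  move=> k s _ ->; rewrite /body /=; split=> //.
  by apply/ffunP=> l; rewrite !ffunE; case: eqP.
rewrite -/loop -cardE set0U; move: loop => loop -> cost.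
exists (loop.2 + (#|E| + (#|E| + 0))); split=> //.
by move: cost; move: #|K| #|E| => a b; lia.
Qed.

Lemma construct_sets_spec :
  exists F B t,
    [/\ construct_sets Kof elems order E F B t, least_closed F B
      & t <= 2 * #|K| + 7 * #|E| + 4 + potential B + 10 * #|F|].
Proof.
have [u [init cost0]] := initialize_spec.
have [| F [B [v [run lcl cost]]]] := @rounds_spec 0 E E [ffun=> set0].
  split=> // [p ->//||C D /closed_sub //].
  split=> [|k j a|C D clo]; first by rewrite disjoints_subset sub0set.
    by rewrite ffunE inE.
  by split=> [|k]; rewrite ?ffunE sub0set.
exists F, B, (u + v); split=> //; last by lia.
by exists [ffun=> set0], E, E, u, v.
Qed.

(** * The quadratic bound *)

Lemma sum_card_classes : \sum_k #|A k| = n.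
Proof.
rewrite -[RHS]card_ord -sum1_card (partition_big Kof predT) //=.
apply: eq_bigr => k _; rewrite -sum1_card; apply: eq_bigl => i.
by rewrite A_fiber eq_sym.
Qed.

Hypothesis A_neq0 : forall k, A k != set0.

Lemma card_classes_le : #|K| <= n.
Proof.
rewrite -[X in _ <= X]sum_card_classes -sum1_card.
by apply: leq_sum => k _; rewrite card_gt0.
Qed.

(** Each [B k] has at most [n] elements, and the weights sum to [4 * n + 2 * #|K|], at most
    [6 * n]. *)
Lemma potential_le (B : K -> {set 'I_n}) : potential B <= 6 * n ^ 2.
Proof.
apply: (@leq_trans (\sum_k n * weight k)).
  apply: leq_sum => k _; rewrite leq_mul2r; apply/orP; right.
  by rewrite -[X in _ <= X]card_ord max_card.
rewrite -big_distrr big_split /= -big_distrr /= sum_card_classes sum_nat_const.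
by move: #|K| card_classes_le => m; nia.
Qed.

(** The constant is 25 = 2 + 7 + 6 + 10, from the classes, [E], the potential and [F]. *)
Lemma construct_sets_quadratic :
  exists F B t,
    [/\ construct_sets Kof elems order E F B t, least_closed F B
      & t <= 25 * n ^ 2 + 4].
Proof.
have [F [B [t [run lcl cost]]]] := construct_sets_spec.
exists F, B, t; split=> //.
have card_pairs (S : pairs) : #|S| <= n ^ 2.
  by have := max_card (mem S); rewrite card_prod card_ord.
move: cost card_classes_le (card_pairs E) (card_pairs F) (potential_le B).
by move: #|K| #|E| #|F| (potential B) => a b c d; nia.
Qed.

End LeastClosedPair.

Theorem mainTheorem3 :
  exists c : nat,
  forall (R : realFieldType) (n : nat) (K : finType)
    (A : K -> {set 'I_n}) (Kof : 'I_n -> K)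
    (E : {set 'I_n * 'I_n}) (w_eqn w_var : R)
    (elems : K -> seq 'I_n)
    (order : nat -> {set 'I_n * 'I_n} -> seq ('I_n * 'I_n)),
  (forall k, A k != set0) ->
  (forall k l, k != l -> [disjoint A k & A l]) ->
  \bigcup_(k : K) A k = [set: 'I_n] ->
  (forall i, i \in A (Kof i)) ->
  (forall i j : 'I_n, (i, j) \in E -> (i <= j)%N) ->
  0 <= w_eqn -> 0 <= w_var ->
  (forall k, enumerates (elems k) (A k)) ->
  (forall r S, enumerates (order r S) S) ->
  exists (F : {set 'I_n * 'I_n}) (B : {ffun K -> {set 'I_n}}) (t : nat),
    [/\ construct_sets Kof elems order E F B t,
        (0 < n)%N -> (t <= c * n ^ 3)%N
      & optimal A E w_eqn w_var
          (fun i j => ((i, j) \in F)%:R) (fun i k => (i \in B k)%:R)].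
Proof.
(* 29 = 25 + 4: for positive [n] the additive 4 is absorbed into the quadratic term. *)
exists 29%N => R n K A Kof E w_eqn w_var elems order A0 Adis _ AK Ele w1 w2 eP oP.
have Afib i k : (i \in A k) = (k == Kof i).
  apply/idP/eqP => [ik|->//]; apply/eqP/negPn/negP => /Adis /disjointFr.
  by move=> /(_ _ ik); rewrite AK.
have [F [B [t [run lcl cost]]]] := construct_sets_quadratic E Afib eP oP A0.
exists F, B, t; split=> //; last exact: least_closed_optimal.
move=> n0; apply: leq_trans cost _.
have n2 : (0 < n ^ 2)%N by rewrite expn_gt0 n0.
by rewrite (expnS n 2); nia.
Qed.
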